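(* Let $k$ be a field, $S=k[x_1,\dots,x_n]$, $\mathfrak m=(x_1,\dots,x_n)$, and $I=(f_1,\dots,f_r)$ a linearly presented $\mathfrak m$-primary ideal of $S$. Let $\Phi:\mathbb P^{n-1}\to\mathbb P^{r-1}$ be the map defined by $f_1,\dots,f_r$, $W$ its image, $B=k[T_1,\dots,T_r]$, and $I(W)\subseteq B$ the homogeneous ideal of $W$. Let $\Theta$ be the Jacobian dual matrix of a presentation matrix of $I$ and $I_n(\Theta)$ its ideal of $n\times n$ minors. Then $$I_n(\Theta)^{\mathrm{sat}}=I(W),$$ i.e. $W$ is scheme-theoretically defined by the maximal minors of $\Theta$.
   Context: ''Linearly presented'' means $I$ is generated by forms of a common degree and its syzygy module is generated by linear syzygies $\sum_i a_i(\mathbf x)f_i=0$. The defining ideal $J$ of $\mathrm{Sym}(I)$ in $k[\mathbf x,\mathbf T]$ is generated by the bilinear forms $\sum_i a_i(\mathbf x)T_i$; with $L_1,\dots,L_N$ minimal generators of $J$, the Jacobian dual $\Theta$ is the $N\times n$ matrix of linear forms in the $T_i$ with $\Theta(x_1,\dots,x_n)^T=(L_1,\dots,L_N)^T$. $I(W)$ is the kernel of $B\to S$, $T_i\mapsto f_i$. Saturation is with respect to $(T_1,\dots,T_r)$. *)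

(* Defs.v *)
From HB Require Import structures.
From mathcomp Require Import all_boot all_order all_algebra.
From mathcomp Require Import mpoly.
Set Implicit Arguments. Unset Strict Implicit. Unset Printing Implicit Defensive.
Import GRing.Theory.
Local Open Scope ring_scope.

Definition in_ideal_gen (R : comRingType) (G : R -> Prop) (p : R) : Prop :=
  exists (m : nat) (c g : 'I_m -> R), (forall i, G (g i)) /\ p = \sum_(i < m) c i * g i.

Definition gens_of (R : comRingType) (r : nat) (f : 'I_r -> R) : R -> Prop :=
  fun q => exists i, q = f i.

Definition irrelevant_gens (k : fieldType) (n : nat) : {mpoly k[n]} -> Prop :=
  fun q => exists i : 'I_n, q = 'X_i.

Definition m_primary (k : fieldType) (n : nat) (I : {mpoly k[n]} -> Prop) : Prop :=
  forall p, (exists e : nat, I (p ^+ e)) <-> in_ideal_gen (@irrelevant_gens k n) p.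

(* Saturation of J w.r.t. the irrelevant ideal (T_1..T_r):
   J^sat = U_N (J : (T)^N), with (T)^N generated by the monomials of degree N. *)
Definition saturation (k : fieldType) (r : nat) (J : {mpoly k[r]} -> Prop)
  : {mpoly k[r]} -> Prop :=
  fun p => exists N : nat, forall m : 'X_{1..r}, mdeg m = N -> J ('X_[m] * p).

(* Jacobian dual of a presentation matrix phi (r x N, linear entries in x):
   L_j = sum_k phi_{k j} T_k = sum_i x_i Theta_{j i}, so
   Theta_{j i} = sum_k (coefficient of x_i in phi_{k j}) T_k. *)
Definition jacobian_dual (k : fieldType) (n r N : nat)
  (phi : 'M[{mpoly k[n]}]_(r, N)) : 'M[{mpoly k[r]}]_(N, n) :=
  \matrix_(j < N, i < n) \sum_(l < r) ((phi l j)@_(U_(i))%MM *: 'X_l).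

Definition maximal_minors (R : comRingType) (N n : nat) (A : 'M[R]_(N, n)) : R -> Prop :=
  fun q => exists s : 'I_n -> 'I_N, injective s /\ q = \det (rowsub s A).

(* Homogeneous ideal I(W) of the image: kernel of B -> S, T_l |-> f_l. *)
Definition image_ideal (k : fieldType) (n r : nat) (f : 'I_r -> {mpoly k[n]})
  : {mpoly k[r]} -> Prop :=
  fun p => comp_mpoly [tuple f l | l < r] p = 0.

Definition is_syzygy (k : fieldType) (n r : nat) (f : 'I_r -> {mpoly k[n]})
  (a : 'I_r -> {mpoly k[n]}) : Prop := \sum_(l < r) a l * f l = 0.

Definition is_presentation (k : fieldType) (n r N : nat) (f : 'I_r -> {mpoly k[n]})
  (phi : 'M[{mpoly k[n]}]_(r, N)) : Prop :=
  (forall j : 'I_N, is_syzygy f (fun l => phi l j)) /\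
  (forall a, is_syzygy f a ->
     exists c : 'I_N -> {mpoly k[n]}, forall l, a l = \sum_(j < N) c j * phi l j).

(* Main.v *)
(* Let B = k[T], and let A_j be the ideal of j x j minors of Theta. If the entries of
   Theta z lie in an ideal A of a B-algebra, then f_b(z) T_a = f_a(z) T_b modulo A,
   because the Koszul syzygies are combinations of the linear ones. Cramer's rule
   produces, from a j x j submatrix of Theta with determinant delta, vectors z with
   Theta z = 0 modulo A_(j+1) and delta as a coordinate.
   - For p in I(W) and j = n - 1 this yields f_b(z)^e p in A_n, and since I is
     m-primary a power of delta multiplies p into A_n.
   - For j < n - 1 there are two independent such vectors x, y. The form
     f_l(x + v y), of degree d > 0 in v, then divides T_l delta^e modulo A_(j+1),
     and so does its leading coefficient f_l(y). Hence T_l delta is in rad A_(j+1).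
   Induction on j puts T_l in rad A_(n-1), so powers of all T_l multiply p into A_n.
   Conversely the minors vanish on W since Theta(f) x = 0. *)
Require Import Defs.
From HB Require Import structures.
From mathcomp Require Import all_boot all_order all_algebra.
From mathcomp Require Import mpoly ring.
Set Implicit Arguments. Unset Strict Implicit. Unset Printing Implicit Defensive.
Import GRing.Theory.
Local Open Scope ring_scope.

(** * Ideals as predicates: radicals, colon ideals, extension to polynomials *)

Record is_ideal (R : comNzRingType) (A : R -> Prop) : Prop := IsIdeal {
  ideal0 : A 0;
  idealD : forall x y, A x -> A y -> A (x + y);
  idealMl : forall a x, A x -> A (a * x) }.

Definition radical (R : comNzRingType) (A : R -> Prop) : R -> Prop :=
  fun x => exists e, A (x ^+ e).

Definition colon (R : comNzRingType) (A : R -> Prop) (p : R) : R -> Prop :=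
  fun x => A (x * p).

Definition poly_ideal (R : comNzRingType) (A : R -> Prop) : {poly R} -> Prop :=
  fun P => forall i, A P`_i.

Section Ideals.
Variables (R : comNzRingType) (A : R -> Prop).
Hypothesis idA : is_ideal A.

Lemma idealN x : A x -> A (- x).
Proof. by rewrite -mulN1r; apply: (idealMl idA). Qed.

Lemma idealB x y : A x -> A y -> A (x - y).
Proof. by move=> Ax Ay; apply: (idealD idA) => //; apply: idealN. Qed.

Lemma ideal_sum (I : Type) (s : seq I) (P : pred I) (F : I -> R) :
  (forall i, P i -> A (F i)) -> A (\sum_(i <- s | P i) F i).
Proof.
by move=> AF; apply: big_ind => //; [apply: (ideal0 idA) | apply: (idealD idA)].
Qed.

Lemma ideal_congrM x y x' y' : A (x - y) -> A (x' - y') -> A (x * x' - y * y').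
Proof.
move=> Axy Axy'; have -> : x * x' - y * y' = x' * (x - y) + y * (x' - y') by ring.
by apply: (idealD idA) => //; apply: (idealMl idA).
Qed.

Lemma ideal_congrX x y e : A (x - y) -> A (x ^+ e - y ^+ e).
Proof.
move=> Axy; elim: e => [|e IHe]; first by rewrite subrr; apply: (ideal0 idA).
by rewrite !exprS; apply: ideal_congrM.
Qed.

Lemma ideal_le_exp x a b : (a <= b)%N -> A (x ^+ a) -> A (x ^+ b).
Proof. by move=> /subnK <-; rewrite exprD; apply: (idealMl idA). Qed.

Lemma radicalX x e : radical A (x ^+ e) -> radical A x.
Proof. by case=> a; rewrite -exprM; exists (e * a)%N. Qed.

Lemma radical_ideal : is_ideal (radical A).
Proof.
split=> [|x y [a Ax] [b Ay]|c x [a Ax]].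
- by exists 1%N; apply: (ideal0 idA).
- exists (a + b)%N; rewrite exprDn; apply: ideal_sum => i _.
  rewrite -mulr_natl; apply: (idealMl idA).
  have [le_bi | lt_ib] := leqP b i; first by apply: (idealMl idA); apply: ideal_le_exp Ay.
  rewrite mulrC; apply: (idealMl idA); apply: ideal_le_exp Ax.
  by rewrite -addnBA ?leq_addr // ltnW.
- by exists a; rewrite exprMn; apply: (idealMl idA).
Qed.

Lemma colon_ideal p : is_ideal (colon A p).
Proof.
split=> [|x y Ax Ay|c x Ax]; rewrite /colon.
- by rewrite mul0r; apply: (ideal0 idA).
- by rewrite mulrDl; apply: (idealD idA).
- by rewrite -mulrA; apply: (idealMl idA).
Qed.

Lemma poly_ideal_ideal : is_ideal (poly_ideal A).
Proof.
split=> [i|P Q AP AQ i|P Q AQ i]; rewrite ?coef0 ?coefD ?coefM.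
- exact: ideal0.
- exact: (idealD idA).
- by apply: ideal_sum => j _; apply: (idealMl idA).
Qed.

Lemma poly_idealC x : A x -> poly_ideal A x%:P.
Proof. by move=> Ax i; rewrite coefC; case: ifP => // _; apply: (ideal0 idA). Qed.

(* Modulo A and with tau inverted, F has degree d > 0 and a unit as leading
   coefficient, so it can only divide a unit in the zero ring. *)
Lemma radical_of_poly_factor (F H : {poly R}) (d : nat) (tau c : R) :
  (0 < d)%N -> (size F <= d.+1)%N ->
  poly_ideal A (F * H - tau%:P) -> A (F`_d * c - tau) -> radical A tau.
Proof.
move=> d_gt0 sF AFH Atau.
(* Descending induction on [i]: the coefficient of [F * H] in degree [d + i] is that of [F] in
   degree [d] times that of [H] in degree [i], up to later coefficients of [H]. *)
have Htop m : forall i, (size H <= i + m)%N -> A (tau ^+ m * H`_i).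
  elim: m => [|m IHm] i.
    by rewrite addn0 => /leq_sizeP-> //; rewrite mulr0; apply: (ideal0 idA).
  rewrite leq_eqVlt => /orP[/eqP sH|]; last first.
    by rewrite addnS ltnS exprS -mulrA => /IHm; apply: (idealMl idA).
  have AFd : A (tau ^+ m * (F`_d * H`_i)).
    have := AFH (d + i)%N; rewrite coefB coefC addn_eq0 -leqn0 leqNgt d_gt0 /= subr0.
    have lt_d : (d < (d + i).+1)%N by rewrite ltnS leq_addr.
    rewrite coefM (bigD1 (Ordinal lt_d)) //= addKn => AS.
    rewrite -[F`_d * _](addrK
      (\sum_(j < (d + i).+1 | j != Ordinal lt_d) F`_j * H`_(d + i - j))).
    rewrite mulrBr; apply: idealB; first exact: (idealMl idA).
    rewrite mulr_sumr; apply: ideal_sum => j; rewrite -val_eqE /= => neq_jd.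
    have [lt_jd|lt_dj|eq_jd] := ltngtP j d; last by rewrite eq_jd eqxx in neq_jd.
      rewrite mulrCA; apply: (idealMl idA); apply: IHm; rewrite -ltnS -addnS sH.
      by rewrite -addSn leq_add2r ltn_subRL ltn_add2r.
    by rewrite [F`_j](leq_sizeP _ _ sF) // mul0r mulr0; apply: (ideal0 idA).
  have -> : tau ^+ m.+1 * H`_i =
      c * (tau ^+ m * (F`_d * H`_i)) - tau ^+ m * H`_i * (F`_d * c - tau).
    by rewrite exprS; ring.
  by apply: idealB; apply: (idealMl idA).
(* In degree [0] the product is [tau] modulo [A], and a power of [tau] kills the factor from [H]. *)
have A0 := AFH 0%N; rewrite coefB coefC eqxx coefM big_ord1 subn0 in A0.
exists (size H).+1; rewrite exprSr.
have -> : tau ^+ size H * tau =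
    F`_0 * (tau ^+ size H * H`_0) - tau ^+ size H * (F`_0 * H`_0 - tau) by ring.
by apply: idealB; apply: (idealMl idA) => //; apply: Htop.
Qed.

End Ideals.

(** * Generated ideals, ideals of minors and Cramer's rule *)

Lemma in_ideal_gen_ideal (R : comNzRingType) (G : R -> Prop) : is_ideal (in_ideal_gen G).
Proof.
split=> [|x y [a [c [g [Gg ->]]]] [b [c' [g' [Gg' ->]]]]|u x [a [c [g [Gg ->]]]]].
- by exists 0%N, (fun=> 0), (fun=> 0); split=> [[]//|]; rewrite big_ord0.
- exists (a + b)%N, (fun i => match split i with inl j => c j | inr j => c' j end),
    (fun i => match split i with inl j => g j | inr j => g' j end).
  split=> [i|]; first by case: (split i).
  by rewrite big_split_ord; congr (_ + _); apply: eq_bigr => i _;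
    rewrite ?(unsplitK (inl i)) ?(unsplitK (inr i)).
- exists a, (fun i => u * c i), g; split=> //.
  by rewrite mulr_sumr; apply: eq_bigr => i _; rewrite mulrA.
Qed.

Lemma in_ideal_gen_gen (R : comNzRingType) (G : R -> Prop) x : G x -> in_ideal_gen G x.
Proof.
by exists 1%N, (fun=> 1), (fun=> x); split=> //; rewrite big_ord1 mul1r.
Qed.

(** Serves as an induction principle: a property that defines an ideal need only be checked on
    generators. *)
Lemma in_ideal_gen_min (R : comNzRingType) (G A : R -> Prop) :
  is_ideal A -> (forall x, G x -> A x) -> forall x, in_ideal_gen G x -> A x.
Proof.
move=> idA GA _ [m [c [g [Gg ->]]]].
by apply: ideal_sum => // i _; apply: (idealMl idA); apply: GA.
Qed.

(** The index maps need not be injective: a repeated row or column only adds the minor [0]. For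
    [j = 0] the empty minor is [1]. *)
Definition minors_ideal (R : comNzRingType) (N n : nat) (A : 'M[R]_(N, n)) (j : nat) :
  R -> Prop :=
  in_ideal_gen (fun q => exists (s : 'I_j -> 'I_N) (t : 'I_j -> 'I_n),
    q = \det (mxsub s t A)).

Lemma minors_ideal_ideal (R : comNzRingType) (N n : nat) (A : 'M[R]_(N, n)) j :
  is_ideal (minors_ideal A j).
Proof. exact: in_ideal_gen_ideal. Qed.

(** Selecting columns is right multiplication by a square matrix, so the minor is a multiple of the
    one with all columns; repeated rows give [0]. *)
Lemma minors_ideal_max (R : comNzRingType) (N n : nat) (A : 'M[R]_(N, n)) x :
  minors_ideal A n x -> in_ideal_gen (maximal_minors A) x.
Proof.
apply: in_ideal_gen_min; first exact: in_ideal_gen_ideal.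
move=> _ [s [t ->]].
rewrite mxsubcr -[rowsub s A]mulmx1 -mulmx_colsub det_mulmx mulrC.
apply: (idealMl (in_ideal_gen_ideal _)).
have [inj_s|] := boolP (injectiveb s).
  by apply: in_ideal_gen_gen; exists s; split=> //; apply/injectiveP.
case/injectivePn=> i1 [i2 neq_i eq_s]; rewrite (determinant_alternate neq_i).
  exact: (ideal0 (in_ideal_gen_ideal _)).
by move=> j; rewrite !mxE eq_s.
Qed.

(** The coordinates of [z] are signed minors of the rows [s] in the columns [i0], [t]; pairing them
    with row [a] is the Laplace expansion of a minor of size [j.+1] along its first row. *)
Lemma cramer_kernel_vector (R : comNzRingType) (N n j : nat) (A : 'M[R]_(N, n))
    (s : 'I_j -> 'I_N) (t : 'I_j -> 'I_n) (i0 : 'I_n) :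
  i0 \notin codom t ->
  exists z : 'I_n -> R,
    [/\ z i0 = \det (mxsub s t A),
        forall i, i != i0 -> i \notin codom t -> z i = 0
      & forall a, minors_ideal A j.+1 (\sum_i A a i * z i)].
Proof.
move=> i0t; pose g k := oapp t i0 (unlift ord0 k).
pose w (k : 'I_j.+1) := (-1) ^+ k * \det (mxsub s (g \o lift k) A).
have g0 : g ord0 = i0 by rewrite /g unlift_none.
have gS k : g (lift ord0 k) = t k by rewrite /g liftK.
(* [t] may repeat a column, so the cofactors belonging to one column are summed. *)
exists (fun i => \sum_(k | g k == i) w k); split.
- rewrite (bigD1 ord0) ?g0 //= big1 ?addr0.
    rewrite /w expr0 mul1r; congr (\det _); apply/matrixP=> a b.
    by rewrite !mxE /= gS.
  move=> k; case: (unliftP ord0 k) => [k' ->|->]; last by rewrite eqxx andbF.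
  by rewrite gS => /andP[/eqP eq_t]; rewrite -eq_t codom_f in i0t.
- move=> i neq_i it; rewrite big1 // => k; case: (unliftP ord0 k) => [k' ->|->].
    by rewrite gS => /eqP eq_t; rewrite -eq_t codom_f in it.
  by rewrite g0 eq_sym (negPf neq_i).
move=> a; apply: in_ideal_gen_gen.
exists (fun i => oapp s a (unlift ord0 i)), g.
rewrite (expand_det_row _ ord0) [RHS](partition_big g xpredT) //=.
apply: eq_bigr => i _; rewrite mulr_sumr; apply: eq_bigr => k /eqP <-.
rewrite !mxE unlift_none /= /cofactor add0n; congr (_ * (_ * \det _)).
by apply/matrixP=> b c; rewrite !mxE liftK.
Qed.

(** * Top coefficients of polynomials in one variable *)

Section TopCoefficient.
Variable R : comNzRingType.

(** [c] may be zero, so [d] only bounds the degree; unlike [lead_coef], this is multiplicative in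
    the presence of zero divisors. *)
Definition top_coef_at (P : {poly R}) (d : nat) (c : R) :=
  (size P <= d.+1)%N /\ P`_d = c.

Lemma top_coef_atM P a x Q b y :
  top_coef_at P a x -> top_coef_at Q b y -> top_coef_at (P * Q) (a + b) (x * y).
Proof.
move=> [sP <-] [sQ <-]; split.
  apply: leq_trans (size_polyMleq _ _) _.
  by have := leq_add sP sQ; rewrite addnS; case: (_ + _)%N.
have lt_a : (a < (a + b).+1)%N by rewrite ltnS leq_addr.
rewrite coefM (bigD1 (Ordinal lt_a)) //= addKn big1 ?addr0 // => i.
rewrite -val_eqE /= => neq_i; have [lt_ia|lt_ai|eq_i] := ltngtP i a.
- by rewrite [Q`_ _](leq_sizeP _ _ sQ) ?mulr0 // ltn_subRL ltn_add2r.
- by rewrite [P`_ _](leq_sizeP _ _ sP) ?mul0r.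
- by rewrite eq_i eqxx in neq_i.
Qed.

Lemma top_coef_atX P a x e : top_coef_at P a x -> top_coef_at (P ^+ e) (a * e) (x ^+ e).
Proof.
move=> Px; elim: e => [|e IHe]; last by rewrite !exprS mulnS; apply: top_coef_atM.
by rewrite muln0 !expr0; split; rewrite ?size_poly1 ?coef1.
Qed.

(** On the line [x + y 'X] each monomial of degree [d] has its value at [y] as coefficient of degree
    [d], and these add up. *)
Lemma top_coef_at_mmap (k : fieldType) (n d : nat) (h : {rmorphism k -> R})
    (x y : 'I_n -> R) (p : {mpoly k[n]}) :
  p \is d.-homog ->
  top_coef_at (mmap (polyC \o h) (fun i => (x i)%:P + (y i)%:P * 'X) p) d (mmap h y p).
Proof.
move=> /dhomogP hp; rewrite /mmap /top_coef_at.
have top m : m \in msupp p ->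
    top_coef_at ((polyC \o h) p@_m * mmap1 (fun i => (x i)%:P + (y i)%:P * 'X) m)
      d (h p@_m * mmap1 y m).
  move=> /hp /= <-; rewrite -[mdeg m]add0n; apply: top_coef_atM.
    by split; rewrite ?coefC //= size_polyC leq_b1.
  rewrite mdegE /mmap1; apply: (big_rec3 (fun q e c => top_coef_at q e c)).
    by split; rewrite ?size_poly1 ?coef1.
  move=> i c e q _ Hq; apply: top_coef_atM => //.
  rewrite -[X in top_coef_at _ X _]mul1n; apply: top_coef_atX; split.
    by rewrite addrC size_MXaddC; case: ifP => // _; rewrite ltnS size_polyC leq_b1.
  by rewrite addrC coefD coefMX !coefC /= addr0.
split; last by rewrite coef_sum; apply: eq_big_seq => m /top [].
apply: leq_trans (size_sum _ _ _) _; apply/bigmax_leqP_seq => m mp _.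
by have [] := top _ mp.
Qed.

End TopCoefficient.

(** * Evaluating the symmetric algebra at a vector [z] *)

Lemma linear_formE (k : fieldType) (n : nat) (p : {mpoly k[n]}) :
  p \is 1.-homog -> p = \sum_i p@_(U_(i))%MM *: 'X_i.
Proof.
move=> hp; apply/mpolyP=> m; rewrite linear_sum /=.
have [/eqP|ne_m] := eqVneq (mdeg m) 1%N; last first.
  rewrite (dhomog_nemf_coeff hp ne_m) big1 // => i _.
  rewrite linearZ /= mcoeffX; case: eqP => [eq_m|_]; last by rewrite mulr0.
  by rewrite -eq_m mdeg1 eqxx in ne_m.
move=> /mdeg1P[i /eqP->].
rewrite (bigD1 i) //= linearZ /= mcoeffX eqxx mulr1 big1 ?addr0 // => j ne_j.
rewrite linearZ /= mcoeffX; case: eqP => [/eqP|_]; last by rewrite mulr0.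
by rewrite eq_mnm1 (negPf ne_j).
Qed.

(* For a B-algebra C, the map S -> C sending x to z. *)
Definition base_eval (k : fieldType) (n r : nat) (C : comNzRingType)
    (iota : {rmorphism {mpoly k[r]} -> C}) (z : 'I_n -> C) : {mpoly k[n]} -> C :=
  mmap (iota \o @mpolyC r k) z.

HB.instance Definition _ (k : fieldType) (n r : nat) (C : comNzRingType)
    (iota : {rmorphism {mpoly k[r]} -> C}) (z : 'I_n -> C) :=
  GRing.RMorphism.on (base_eval iota z).

Section BaseEval.
Variables (k : fieldType) (n r N : nat) (C : comNzRingType).
Variables (iota : {rmorphism {mpoly k[r]} -> C}) (z : 'I_n -> C).
Local Notation ev := (base_eval iota z).

Lemma base_evalX i : ev 'X_i = z i.
Proof. by rewrite /base_eval mmapX mmap1U. Qed.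

Lemma base_evalZ c p : ev (c *: p) = iota c%:MP * ev p.
Proof. by rewrite /base_eval mmapZ. Qed.

Lemma base_eval_comp (f : 'I_r -> {mpoly k[n]}) (p : {mpoly k[r]}) :
  ev (p \mPo [tuple f l | l < r]) = mmap (iota \o @mpolyC r k) (fun l => ev (f l)) p.
Proof.
rewrite comp_mpolyE rmorph_sum /=; apply: eq_bigr => m _.
rewrite base_evalZ rmorph_prod /=; congr (_ * _); apply: eq_bigr => l _.
by rewrite rmorphXn /= tnth_mktuple.
Qed.

Variables (f : 'I_r -> {mpoly k[n]}) (phi : 'M[{mpoly k[n]}]_(r, N)).
Hypothesis linear_phi : forall l j, phi l j \is 1.-homog.

(** The identity that defines the Jacobian dual, at [x = z]: both sides regroup one double sum. *)
Lemma jacobian_dual_eval j :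
  \sum_l ev (phi l j) * iota 'X_l = \sum_i iota (jacobian_dual phi j i) * z i.
Proof.
under eq_bigr => l _.
  rewrite (linear_formE (linear_phi l j)) rmorph_sum /= mulr_suml.
  under eq_bigr => i _ do rewrite base_evalZ base_evalX.
  over.
rewrite exchange_big; apply: eq_bigr => i _.
rewrite mxE rmorph_sum mulr_suml; apply: eq_bigr => l _.
by rewrite -mul_mpolyC rmorphM /= mulrAC.
Qed.

Variable A : C -> Prop.
Hypothesis idA : is_ideal A.
Hypothesis pres : is_presentation f phi.
Hypothesis kerz : forall j, A (\sum_i iota (jacobian_dual phi j i) * z i).

(* The Koszul syzygy f_b e_a - f_a e_b is a combination of the columns of phi. *)
Lemma koszul_eval a b : A (ev (f b) * iota 'X_a - ev (f a) * iota 'X_b).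
Proof.
pose u l := f b *+ (l == a) - f a *+ (l == b).
(* Used for two morphisms: the identity shows that [u] is a syzygy, [ev] gives the conclusion. *)
have sumu (S : comNzRingType) (g : {rmorphism {mpoly k[n]} -> S}) (y : 'I_r -> S) :
    \sum_l g (u l) * y l = g (f b) * y a - g (f a) * y b.
  under eq_bigr => l _ do rewrite rmorphB mulrBl.
  rewrite sumrB (bigD1 a) //= eqxx big1 ?addr0; last first.
    by move=> l /negPf->; rewrite rmorph0 mul0r.
  rewrite (bigD1 b) //= eqxx big1 ?addr0 //.
  by move=> l /negPf->; rewrite rmorph0 mul0r.
have [c uE] : exists c : 'I_N -> {mpoly k[n]}, forall l, u l = \sum_(j < N) c j * phi l j.
  apply: pres.2; rewrite /is_syzygy.
  by rewrite (sumu _ idfun) /= mulrC subrr.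
rewrite -(sumu _ ev (fun l => iota 'X_l)).
under eq_bigr => l _.
  rewrite uE rmorph_sum /= mulr_suml.
  under eq_bigr => j _ do rewrite rmorphM -mulrA.
  over.
rewrite exchange_big; apply: ideal_sum => // j _.
by rewrite -mulr_sumr jacobian_dual_eval; apply: (idealMl idA).
Qed.

Lemma eval_in_ideal q :
  in_ideal_gen (gens_of f) q -> (forall l, A (ev (f l))) -> A (ev q).
Proof.
move=> Iq Af; move: q Iq; apply: in_ideal_gen_min; last by move=> _ [l ->].
split=> [|x y Ax Ay|a x Ax]; rewrite (rmorph0, rmorphD, rmorphM).
- exact: (ideal0 idA).
- exact: (idealD idA).
- exact: (idealMl idA).
Qed.

(** For [q = f b] the cofactor is [iota 'X_b], by the Koszul relation; the property passes to
    combinations. *)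
Lemma eval_factor l q : in_ideal_gen (gens_of f) q ->
  exists h, A (ev (f l) * h - iota 'X_l * ev q).
Proof.
move: q; apply: in_ideal_gen_min.
  split=> [|x y [h Ah] [h' Ah']|a x [h Ah]].
  - by exists 0; rewrite rmorph0 !mulr0 subrr; apply: (ideal0 idA).
  - exists (h + h'); rewrite rmorphD !mulrDr opprD addrACA.
    exact: (idealD idA).
  - exists (ev a * h); rewrite rmorphM.
    have -> : ev (f l) * (ev a * h) - iota 'X_l * (ev a * ev x) =
       ev a * (ev (f l) * h - iota 'X_l * ev x) by ring.
    exact: (idealMl idA).
move=> _ [b ->]; exists (iota 'X_b); rewrite -opprB [iota _ * _]mulrC.
by apply: idealN => //; apply: koszul_eval.
Qed.

End BaseEval.

(** * Homogeneous components of the ideal of the image *)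

Lemma mpolyX_eq0 (R : nzRingType) (n : nat) (m : 'X_{1..n}) :
  ('X_[m] == 0 :> {mpoly R[n]}) = false.
Proof. by rewrite -msupp_eq0 msuppX. Qed.

Lemma comp_mpoly_dhomog (k : fieldType) (n r d e : nat) (f : 'I_r -> {mpoly k[n]})
    (p : {mpoly k[r]}) :
  (forall l, f l \is d.-homog) -> p \is e.-homog ->
  p \mPo [tuple f l | l < r] \is (d * e).-homog.
Proof.
move=> hf /dhomogP hp; rewrite comp_mpolyE big_seq; apply: rpred_sum => m mp.
apply: dhomogZ; rewrite -(hp _ mp) /= mdegE big_distrr /=.
apply: (big_rec2 (fun q c => q \is c.-homog)); first exact: dhomog1.
by move=> l c q _ hq; apply: dhomogM => //; rewrite tnth_mktuple; apply: dhomogMn.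
Qed.

(** Substituting the [f l] multiplies degrees by [d > 0], so distinct components of [p] cannot
    cancel each other. *)
Lemma image_ideal_pihomog (k : fieldType) (n r d : nat) (f : 'I_r -> {mpoly k[n]})
    (p : {mpoly k[r]}) (e : nat) :
  (0 < d)%N -> (forall l, f l \is d.-homog) ->
  image_ideal f p -> image_ideal f (pihomog mdeg e p).
Proof.
move=> d_gt0 hf pf0; rewrite /image_ideal.
have hcomp a : pihomog mdeg a p \mPo [tuple f l | l < r] \is (d * a).-homog.
  by apply: comp_mpoly_dhomog => //; apply: pihomogP.
have [le_pe|lt_ep] := leqP (msize p) e.
  rewrite pihomogE big_seq_cond big1 ?linear0 // => m /andP[mp /eqP eq_m].
  by have := msize_mdeg_lt mp; rewrite eq_m ltnNge le_pe.
have compE : p \mPo [tuple f l | l < r] =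
    \sum_(c < mmeasure mdeg p) (pihomog mdeg c p \mPo [tuple f l | l < r]).
  by rewrite {1}(pihomog_partitionE (leqnn (mmeasure mdeg p))) (raddf_sum (comp_mpoly _)).
have := congr1 (pihomog mdeg (d * e)) pf0.
rewrite compE pihomog0 (raddf_sum (pihomog mdeg (d * e))).
rewrite (bigD1 (Ordinal lt_ep)) //= (pihomog_dE (hcomp e)) big1 ?addr0 // => a.
rewrite -val_eqE /= => ne_a; apply: pihomog_ne0 (hcomp a).
by rewrite eqn_pmul2l.
Qed.

(** * Minors of the Jacobian dual of a linearly presented ideal *)

Section LinearlyPresented.
Variables (k : fieldType) (n r d N : nat) (f : 'I_r -> {mpoly k[n]}).
Variable phi : 'M[{mpoly k[n]}]_(r, N).
Hypothesis homf : forall l, f l \is d.-homog.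
Hypothesis primf : m_primary (in_ideal_gen (gens_of f)).
Hypothesis pres : is_presentation f phi.
Hypothesis linear_phi : forall l j, phi l j \is 1.-homog.
Local Notation Theta := (jacobian_dual phi).
Local Notation idm := (@minors_ideal_ideal _ _ _ Theta _).

Lemma varX_in_ideal (i : 'I_n) : exists e, in_ideal_gen (gens_of f) ('X_i ^+ e).
Proof. by apply/primf/in_ideal_gen_gen; exists i. Qed.

(** Otherwise [1] would lie in the ideal of the variables, whose elements vanish at the origin. *)
Lemma one_notin_ideal : ~ in_ideal_gen (gens_of f) 1.
Proof.
move=> I1; have : in_ideal_gen (@irrelevant_gens k n) 1 by apply/primf; exists 1%N.
move=> /(@in_ideal_gen_min _ _ (fun q => meval (fun=> 0) q = 0)) m1.
have : meval (fun=> 0) (1 : {mpoly k[n]}) = 0.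
  apply: m1; last by move=> _ [i ->]; rewrite mevalXU.
  split=> [|x y x0 y0|a x x0]; first exact: meval0.
    by rewrite mevalD x0 y0 addr0.
  by rewrite mevalM x0 mulr0.
by move/eqP; rewrite meval1 oner_eq0.
Qed.

Lemma form_neq0 : (0 < n)%N -> exists l, f l != 0.
Proof.
move=> n_gt0; apply/existsP; case: existsP => // f0.
have [e [m [c [g [Gg /eqP]]]]] := varX_in_ideal (Ordinal n_gt0).
rewrite big1 => [|i _]; first by rewrite expf_eq0 mpolyX_eq0 andbF.
have [l ->] := Gg i; have [->|nz_f] := eqVneq (f l) 0; first by rewrite mulr0.
by case: f0; exists l.
Qed.

(** A nonzero form of degree [0] would be a unit in the ideal. *)
Lemma form_degree_gt0 : (0 < n)%N -> (0 < d)%N.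
Proof.
move=> /form_neq0[l nz_f]; rewrite lt0n; apply/eqP=> d0.
have fC : f l = ((f l)@_0%MM)%:MP.
  apply/mpolyP=> m; rewrite mcoeffC; case: eqP => [->|/eqP ne_m]; first by rewrite mulr1.
  by rewrite mulr0 (dhomog_nemf_coeff (homf l)) //= d0 mdeg_eq0.
apply: one_notin_ideal.
have -> : 1 = ((f l)@_0%MM)^-1%:MP * f l :> {mpoly k[n]}.
  by rewrite [X in _ * X]fC -mpolyCM mulVf ?mpolyC1 // -(mpolyC_eq0 n) -fC.
by apply: (idealMl (in_ideal_gen_ideal _)); apply: in_ideal_gen_gen; exists l.
Qed.

(* Geometrically: a point T at which Theta has corank at least 2 would have a line
   in its fibre, on which the forms f_l are all proportional to one form of
   degree d > 0; that form vanishes somewhere on the line, against m-primarity. *)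
Lemma var_minor_radical (j : nat) (s : 'I_j -> 'I_N) (t : 'I_j -> 'I_n) (l : 'I_r) :
  (0 < d)%N -> (j.+1 < n)%N ->
  radical (minors_ideal Theta j.+1) ('X_l * \det (mxsub s t Theta)).
Proof.
move=> d_gt0 lt_jn; set delta := \det _.
have [i0 [i1 [i0t i1t ne_i]]] : exists i0 i1,
    [/\ i0 \notin codom t, i1 \notin codom t & i0 != i1].
  have /card_gt1P[i0 [i1 [i0t i1t ne_i]]] : (1 < #|[predC codom t]|)%N.
    rewrite -(ltn_add2l #|codom t|) cardC card_ord addn1; apply: leq_trans lt_jn.
    by rewrite !ltnS (leq_trans (card_size _)) // size_codom card_ord.
  by exists i0, i1.
have [x [x0 x_out kerx]] := cramer_kernel_vector Theta s i0t.
have [y [y1 y_out kery]] := cramer_kernel_vector Theta s i1t.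
(* Hence the coordinate [i0] of the line [z] below is the constant [delta]. *)
have y0 : y i0 = 0 by apply: y_out.
have [e0 I0] := varX_in_ideal i0; have [e1 I1] := varX_in_ideal i1.
(* With one exponent for both coordinates, both factorizations concern the same
   ['X_l * delta ^+ e]. *)
pose e := (e0 + e1)%N.
have {}I0 : in_ideal_gen (gens_of f) ('X_i0 ^+ e).
  by apply: ideal_le_exp I0; [apply: in_ideal_gen_ideal | apply: leq_addr].
have {}I1 : in_ideal_gen (gens_of f) ('X_i1 ^+ e).
  by apply: ideal_le_exp I1; [apply: in_ideal_gen_ideal | apply: leq_addl].
pose z i := (x i)%:P + (y i)%:P * 'X.
have kerz a : poly_ideal (minors_ideal Theta j.+1) (\sum_i (Theta a i)%:P * z i).
  rewrite (eq_bigr (fun i => (Theta a i * x i)%:P + 'X * (Theta a i * y i)%:P)); last first.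
    by move=> i _; rewrite /z !polyCM; ring.
  rewrite big_split -mulr_sumr -!rmorph_sum /=.
  apply: (idealD (poly_ideal_ideal idm)); first exact: (poly_idealC idm).
  by apply: (idealMl (poly_ideal_ideal idm)); apply: (poly_idealC idm).
have [H AH] := eval_factor linear_phi (poly_ideal_ideal idm) pres (iota := polyC) kerz l I0.
have [c Ac] := eval_factor linear_phi idm pres (iota := idfun) kery l I1.
rewrite rmorphXn /= base_evalX /z x0 y0 polyC0 mul0r addr0 -polyC_exp -polyCM in AH.
rewrite rmorphXn /= base_evalX y1 in Ac.
have [sF topF] := top_coef_at_mmap (@mpolyC r k) x y (homf l).
have : radical (minors_ideal Theta j.+1) ('X_l * delta ^+ e).
  by apply: (radical_of_poly_factor idm d_gt0 sF AH); rewrite topF; apply: Ac.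
(* The exponent [e.+1] keeps a factor ['X_l] even when [e = 0]. *)
move=> rad_tau; apply: (@radicalX _ _ _ e.+1).
have -> : ('X_l * delta) ^+ e.+1 = 'X_l ^+ e * delta * ('X_l * delta ^+ e).
  by rewrite exprMn !exprS; ring.
exact: (idealMl (radical_ideal idm)).
Qed.

(** Induction on [j] from the empty minor: a power of ['X_l] is a combination of minors of size [j],
    and one more factor ['X_l] brings each into the next radical. *)
Lemma var_radical (j : nat) (l : 'I_r) : (0 < d)%N -> (j < n)%N ->
  radical (minors_ideal Theta j) 'X_l.
Proof.
move=> d_gt0; elim: j => [|j IHj] lt_jn.
  exists 0%N; rewrite expr0; apply: in_ideal_gen_gen.
  have empty T : 'I_0 -> T by case.
  by exists (empty _), (empty _); rewrite det_mx00.
have [e Xe] := IHj (ltnW lt_jn); apply: (@radicalX _ _ _ e.+1).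
have := Xe; rewrite exprS; move: ('X_l ^+ e).
apply: in_ideal_gen_min => [|_ [s [t ->]]]; last exact: var_minor_radical.
split=> [|x y Ax Ay|a x Ax]; rewrite (mulr0, mulrDr, mulrCA).
- exact: (ideal0 (radical_ideal idm)).
- exact: (idealD (radical_ideal idm)).
- exact: (idealMl (radical_ideal idm)).
Qed.

(** In a monomial of degree [e], each of the [e] factors [F b * 'X_a] is traded for ['X_b * F a]. *)
Lemma eval_form_congr (A : {mpoly k[r]} -> Prop) (F : 'I_r -> {mpoly k[r]})
    (p : {mpoly k[r]}) (e : nat) (b : 'I_r) :
  is_ideal A -> (forall a, A (F b * 'X_a - F a * 'X_b)) -> p \is e.-homog ->
  A (F b ^+ e * p - 'X_b ^+ e * mmap (@mpolyC r k) F p).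
Proof.
move=> idA AF /dhomogP hp; rewrite {1}(mpolyE p) /mmap !mulr_sumr -sumrB.
rewrite big_seq_cond; apply: ideal_sum => // m /andP[mp _].
rewrite -mul_mpolyC mulrCA [X in _ - X]mulrCA -mulrBr; apply: (idealMl idA).
rewrite -(hp _ mp) /= mdegE -!prodrXr -mmap1_id /mmap1 -!big_split /=.
apply: (big_ind2 (fun u v => A (u - v))).
- by rewrite subrr; apply: (ideal0 idA).
- by move=> u v u' v'; apply: ideal_congrM.
by move=> a _; rewrite -!exprMn; apply: ideal_congrX; rewrite // ['X_b * _]mulrC.
Qed.

(* Substituting for x a Cramer vector turns p f_b ^+ e, which lies in the ideal of
   Sym(I), into an element of the ideal of maximal minors. *)
Lemma minor_radical_colon (j : nat) (s : 'I_j -> 'I_N) (t : 'I_j -> 'I_n) p :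
  (0 < d)%N -> (j < n)%N -> image_ideal f p ->
  radical (colon (minors_ideal Theta j.+1) p) (\det (mxsub s t Theta)).
Proof.
move=> d_gt0 lt_jn pf0.
have [i0 i0t] : exists i0, i0 \notin codom t.
  have /card_gt0P[i0 i0t] : (0 < #|[predC codom t]|)%N.
    rewrite -(ltn_add2l #|codom t|) cardC card_ord addn0; apply: leq_trans lt_jn.
    by rewrite ltnS (leq_trans (card_size _)) // size_codom card_ord.
  by exists i0.
have [z [<- _ kerz]] := cramer_kernel_vector Theta s i0t.
pose ev := base_eval (idfun : {rmorphism {mpoly k[r]} -> {mpoly k[r]}}) z.
have rad_f b : radical (colon (minors_ideal Theta j.+1) p) (ev (f b)).
  (* The component of degree [e] needs the exponent [e]; [msize p] exceeds all these degrees. *)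
  exists (msize p).
  rewrite /colon {2}(pihomog_partitionE (leqnn (mmeasure mdeg p))) mulr_sumr.
  apply: ideal_sum => [|e _]; first exact: idm.
  have he := pihomogP mdeg e p.
  apply: (ideal_le_exp (colon_ideal idm (pihomog mdeg e p)) (ltnW (ltn_ord e))).
  rewrite /colon.
  have AF a : minors_ideal Theta j.+1 (ev (f b) * 'X_a - ev (f a) * 'X_b).
    exact: (koszul_eval linear_phi idm pres (iota := idfun)).
  have := eval_form_congr idm AF he.
  have := base_eval_comp idfun z f (pihomog mdeg e p).
  rewrite (image_ideal_pihomog _ d_gt0 homf pf0) rmorph0 => <-.
  by rewrite mulr0 subr0.
have [e Ie] := varX_in_ideal i0.
have := eval_in_ideal (radical_ideal (colon_ideal idm p)) Ie rad_f.
by rewrite rmorphXn /= base_evalX; apply: radicalX.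
Qed.

(** A power of ['X_l] is a combination of minors of size [n.-1], all of which lie in the radical of
    the colon ideal. *)
Lemma var_radical_colon p l : (0 < n)%N -> image_ideal f p ->
  radical (colon (in_ideal_gen (maximal_minors Theta)) p) 'X_l.
Proof.
move=> n_gt0 pf0; have d_gt0 := form_degree_gt0 n_gt0.
have lt_n : (n.-1 < n)%N by rewrite prednK.
have [e Xe] := var_radical l d_gt0 lt_n.
have: radical (colon (minors_ideal Theta n) p) 'X_l.
  apply: (@radicalX _ _ _ e); move: ('X_l ^+ e) Xe.
  apply: in_ideal_gen_min => [|_ [s [t ->]]]; first exact/radical_ideal/colon_ideal/idm.
  by have := minor_radical_colon s t d_gt0 lt_n pf0; rewrite prednK.
by case=> a Aa; exists a; apply: minors_ideal_max.
Qed.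

(** After substitution the square submatrix kills the column of variables; its adjugate then gives
    determinant times variable [= 0] in a domain. *)
Lemma maximal_minors_image q : (0 < n)%N ->
  in_ideal_gen (maximal_minors Theta) q -> image_ideal f q.
Proof.
move=> n_gt0; apply: in_ideal_gen_min.
  split=> [|x y x0 y0|a x x0]; rewrite /image_ideal ?linear0 //.
    by rewrite linearD /= x0 y0 addr0.
  by rewrite rmorphM /= x0 mulr0.
move=> _ [s [_ ->]]; rewrite /image_ideal -det_map_mx.
set M := map_mx _ _; pose x : 'cV[{mpoly k[n]}]_n := \col_i 'X_i.
have Mx : M *m x = 0.
  apply/matrixP=> a b; rewrite !mxE.
  (* With ['X_l] sent to [f l] and [z] the variables themselves, evaluation is the identity on
     [S]. *)
  have := jacobian_dual_eval (comp_mpoly [tuple f l | l < r]) (fun i => 'X_i)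
    linear_phi (s a).
  have evE g : base_eval (comp_mpoly [tuple f l | l < r]) (fun i => 'X_i) g = g.
    rewrite {2}(mpolyE g); apply: eq_bigr => m _.
    by rewrite mmap1_id /= comp_mpolyC mul_mpolyC.
  rewrite (eq_bigr (fun l => phi l (s a) * f l)); last first.
    by move=> l _; rewrite evE /= comp_mpolyXU -tnth_nth tnth_mktuple.
  rewrite (pres.1 (s a)) => sum0; rewrite [RHS]sum0.
  by apply: eq_bigr => i _; rewrite !mxE.
have /matrixP/(_ (Ordinal n_gt0) ord0) : \det M *: x = 0.
  by rewrite -mul_scalar_mx -mul_adj_mx -mulmxA Mx mulmx0.
by rewrite !mxE => /eqP; rewrite mulf_eq0 mpolyX_eq0 orbF => /eqP.
Qed.

End LinearlyPresented.

(** * Saturation and the final equality *)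

Lemma monomial_large_exponent (r a : nat) (m : 'X_{1..r}) :
  (r * a < mdeg m)%N -> exists l, (a <= m l)%N.
Proof.
move=> lt_m; apply/existsP; apply: contraLR lt_m => /existsPn small.
rewrite -leqNgt mdegE -[r in (r * a)%N]card_ord -sum_nat_const.
by apply: leq_sum => l _; rewrite ltnW // ltnNge small.
Qed.

Theorem theorem2p11 (k : fieldType) (n r d : nat) (f : 'I_r -> {mpoly k[n]})
  (N : nat) (phi : 'M[{mpoly k[n]}]_(r, N)) :
  (0 < n)%N ->
  (forall l, f l \is d.-homog) ->
  m_primary (in_ideal_gen (gens_of f)) ->
  is_presentation f phi ->
  (forall l j, phi l j \is 1.-homog) ->
  forall p : {mpoly k[r]},
    saturation (in_ideal_gen (maximal_minors (jacobian_dual phi))) p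
    <-> image_ideal f p.
Proof.
move=> n_gt0 homf primf pres linear_phi p; split=> [[e satp]|pf0].
  (* The image [f l ^+ e] of a power of this ['X_l] is nonzero and can be cancelled. *)
  have [l nz_f] := form_neq0 primf n_gt0.
  have := satp (U_(l) *+ e)%MM; rewrite mdegMn mdeg1 mul1n -mpolyXn => /(_ erefl).
  move=> /(maximal_minors_image pres linear_phi n_gt0) /eqP.
  rewrite rmorphM rmorphXn /= comp_mpolyXU -tnth_nth tnth_mktuple.
  by rewrite mulf_eq0 expf_eq0 (negPf nz_f) andbF => /eqP.
have idI := in_ideal_gen_ideal (maximal_minors (jacobian_dual phi)).
have [a Xa] : exists a, forall l,
    colon (in_ideal_gen (maximal_minors (jacobian_dual phi))) p ('X_l ^+ a).
  have rad l := var_radical_colon homf primf pres linear_phi l n_gt0 pf0.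
  have [g Xg] := fin_all_exists rad.
  exists (\max_l g l)%N => l.
  exact: ideal_le_exp (colon_ideal idI p) _ _ _ (leq_bigmax l) (Xg l).
(* In this degree the pigeonhole principle makes every monomial divisible by some ['X_l ^+ a]. *)
exists (r * a).+1 => m eq_m.
have [l le_al] : exists l, (a <= m l)%N by apply: monomial_large_exponent; rewrite eq_m.
have -> : m = (m - U_(l) *+ a + U_(l) *+ a)%MM.
  rewrite submK //; apply/mnm_lepP=> i; rewrite mulmnE mnm1E.
  by case: eqP => [<-|_]; rewrite ?mul1n ?mul0n.
by rewrite mpolyXD -mpolyXn -mulrA; apply: (idealMl idI); apply: Xa.
Qed.
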